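(* Let $n\geq 1$ and let $S\subseteq \mathbb{Z}^n$ be a finite set such that for each $Q=\langle q_1,\dots,q_n\rangle\in S$ the coordinates satisfy $\gcd(q_1,\dots,q_n)=1$. Then there exists a nonconstant homogeneous polynomial $f\in\mathbb{Z}[x_1,\dots,x_n]$ such that $f(Q)=1$ for each $Q\in S$.
   Context: A homogeneous polynomial of degree $d$ is a linear combination of monomials all of total degree $d$; nonconstant means of degree $d\geq 1$. *)

(* Defs.v *)
From mathcomp Require Export all_boot all_order all_algebra.
From mathcomp Require Export finmap.
From mathcomp Require Export mpoly.

Set Implicit Arguments.
Unset Strict Implicit.
Unset Printing Implicit Defensive.

(* Main.v *)
Require Import Defs.
From mathcomp Require Import all_boot all_order all_algebra.
From mathcomp Require Import finmap mpoly.
From mathcomp Require Import cyclic ring.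

(** Induction on the set, adding one vector Q at a time.  Let f be homogeneous
    with f(P) = 1 at all earlier vectors P.  If u.P = 1, then for every w the
    linear form w.x - (w.P)(u.x) vanishes at P, and Bezout coefficients w of
    R = Q - (u.Q)P make its value at Q equal to D = gcd(R).  Then Q = (u.Q)P
    modulo D, so u.Q is a unit modulo D because Q is primitive, and f(Q), which
    is congruent to a power of u.Q, is coprime to D.  The product g of these
    forms vanishes at all earlier vectors and g(Q) is coprime to f(Q).  Hence
    some power of f(Q) is 1 modulo g(Q), and subtracting a multiple of g times
    a power of a linear form equal to 1 at Q makes the value at Q exactly 1. *)

Set Implicit Arguments.
Unset Strict Implicit.
Unset Printing Implicit Defensive.

Import GRing.Theory Num.Theory.
Local Open Scope ring_scope.

(** Serves twice: it turns primitivity of a vector into a linear form with value 1 there, and it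
    makes the gcd of a difference vector a value of a linear form. *)
Lemma Bezout_big_gcdz (n : nat) (r : 'I_n -> int) :
  exists w : 'I_n -> int, \sum_i w i * r i = \big[gcdz/0]_(i < n) r i.
Proof.
elim: n r => [|n IH] r; first by exists (fun=> 0); rewrite !big_ord0.
have [w Ew] := IH (fun i => r (lift ord0 i)).
have [a [b Eab]] := Bezoutz (r ord0) (\sum_i w i * r (lift ord0 i)).
exists (fun i => if unlift ord0 i is Some j then b * w j else a).
rewrite [RHS]big_ord_recl -Ew -Eab big_ord_recl unlift_none mulr_sumr.
by congr (_ + _); apply: eq_bigr => i _; rewrite liftK mulrA.
Qed.

Lemma dvdz_big_gcdz (n : nat) (r : 'I_n -> int) (i : 'I_n) :
  (\big[gcdz/0]_(j < n) r j %| r i)%Z.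
Proof.
elim: n r i => [|n IH] r i; first by case: i.
rewrite big_ord_recl; have [j ->|->] := unliftP ord0 i.
  exact: dvdz_trans (dvdz_gcdr _ _) (IH (fun k => r (lift ord0 k)) j).
exact: dvdz_gcdl.
Qed.

(* For g = 0 coprimality means a = 1 or a = -1, whence the even exponent. *)
Lemma coprimez_expr_eq1_mod (a g : int) :
  coprimez a g -> exists2 k : nat, (0 < k)%N & (g %| a ^+ k - 1)%Z.
Proof.
have sqrE t : a ^+ (2 * t) = (`|a| ^ (2 * t))%N%:Z.
  by rewrite -abszX gez0_abs // exprn_even_ge0 // oddM.
rewrite coprimezE => co_ag; have [g0|g_gt0] := posnP `|g|%N.
  exists (2 * 1)%N => //; rewrite sqrE.
  by move: co_ag; rewrite g0 /coprime gcdn0 => /eqP->; rewrite exp1n subrr dvdz0.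
(* The factor 2 replaces [a] by its absolute value, so that Euler's theorem over the naturals
   applies. *)
exists (2 * totient `|g|)%N; first by rewrite muln_gt0 totient_gt0.
rewrite sqrE mulnC expnM -eqz_mod_dvd -(modz_abs _ g) -(modz_abs 1 g) !modz_nat.
by rewrite -modnXm Euler_exp_totient // modnXm exp1n.
Qed.

Section Forms.
Variable n : nat.
Implicit Types (u v w x y p q : 'I_n -> int) (f : {mpoly int[n]}).

Definition dot u x : int := \sum_i u i * x i.

Lemma dotB u v x : dot (fun i => u i - v i) x = dot u x - dot v x.
Proof. by rewrite -sumrB; apply: eq_bigr => i _; rewrite mulrBl. Qed.

Lemma dotZ c u x : dot (fun i => c * u i) x = c * dot u x.
Proof. by rewrite mulr_sumr; apply: eq_bigr => i _; rewrite mulrA. Qed.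

Lemma dotC u x : dot u x = dot x u.
Proof. by apply: eq_bigr => i _; rewrite mulrC. Qed.

Definition linear_form w : {mpoly int[n]} := \sum_i w i *: 'X_i.

Lemma linear_form_homog w : linear_form w \is 1.-homog.
Proof. by apply: rpred_sum => i _; apply: dhomogZ; rewrite dhomogX /= mdeg1. Qed.

Lemma meval_linear_form w x : (linear_form w).@[x] = dot w x.
Proof. by rewrite raddf_sum; apply: eq_bigr => i _; rewrite /= mevalZ mevalXU. Qed.

Lemma meval_homogZ (d : nat) f c x :
  f \is d.-homog -> f.@[fun i => c * x i] = c ^+ d * f.@[x].
Proof.
move=> /dhomogP fd; rewrite !mevalE mulr_sumr !big_seq; apply: eq_bigr => m mf.
rewrite mulrCA -(fd m mf) /= mdegE expr_sum; congr (_ * _).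
by rewrite -big_split; apply: eq_bigr => i _; rewrite exprMn.
Qed.

(** Congruence modulo [D] respects sums and products, so it passes through each monomial and then
    through [f]. *)
Lemma dvdz_meval_sub (D : int) f x y :
  (forall i, (D %| x i - y i)%Z) -> (D %| f.@[x] - f.@[y])%Z.
Proof.
move=> Dxy; rewrite !mevalE -sumrB; apply: rpred_sum => m _ /=.
rewrite -mulrBr; apply/dvdz_mull.
apply: (big_ind2 (fun a b => (D %| a - b)%Z)) => [|a b a' b' Dab Dab'|i _].
- by rewrite subrr dvdz0.
- have -> : a * a' - b * b' = (a - b) * a' + b * (a' - b') by ring.
  by apply: rpredD; [apply: dvdz_mulr | apply: dvdz_mull].
- by rewrite subrXX dvdz_mulr.
Qed.

Lemma coprime_linear_form (d : nat) f p q :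
    f \is d.-homog -> f.@[p] = 1 ->
    (exists u, dot u p = 1) -> (exists v, dot v q = 1) ->
  exists2 w, dot w p = 0 & coprimez f.@[q] (dot w q).
Proof.
move=> fd fp [u up] [v vq].
pose r i := q i - dot u q * p i.
have [w wr] := Bezout_big_gcdz r; rewrite -/(dot w r) in wr.
have dotr x : dot x r = dot x q - dot u q * dot x p.
  by rewrite dotC /r dotB dotZ ![dot _ x]dotC.
exists (fun i => w i - dot w p * u i); first by rewrite dotB dotZ up mulr1 subrr.
have -> : dot (fun i => w i - dot w p * u i) q = dot w r.
  by rewrite dotB dotZ dotr [dot w p * _]mulrC.
have Dr i : (dot w r %| r i)%Z by rewrite wr dvdz_big_gcdz.
have co_uq : coprimez (dot u q) (dot w r).
  (* Since [dot v r] equals [1 - dot u q * dot v p], this divisibility is a Bezout identity for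
     [dot u q] and [dot w r]. *)
  have /dvdzP[k Ek] : (dot w r %| dot v r)%Z.
    by apply: rpred_sum => i _; apply/dvdz_mull.
  apply/coprimezP; exists (dot v p, k) => /=.
  by rewrite -Ek dotr vq mulrC addrC subrK.
(* Modulo [dot w r], homogeneity and [fp] reduce [f.@[q]] to [dot u q ^+ d]. *)
have /dvdzP[k Ek] := dvdz_meval_sub f Dr.
rewrite (meval_homogZ _ _ fd) fp mulr1 in Ek.
move/eqP: Ek; rewrite subr_eq => /eqP->.
by rewrite coprimez_sym /coprimez gcdzMDl -/(coprimez _ _) coprimez_sym coprimezXl.
Qed.

Lemma coprime_vanishing_form (d : nat) f q (s : seq 'rV[int]_n) :
    f \is d.-homog -> (exists v, dot v q = 1) ->
    {in s, forall P : 'rV_n, f.@[P 0] = 1 /\ exists u, dot u (P 0) = 1} ->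
  exists g : {mpoly int[n]},
    [/\ g \is (size s).-homog, {in s, forall P : 'rV_n, g.@[P 0] = 0}
      & coprimez f.@[q] g.@[q]].
Proof.
move=> fd vq; elim: s => [|P s IH] fs.
  by exists 1; split; [exact: dhomog1| |rewrite meval1 /coprimez gcdz1].
have [|g [gd gs co_g]] := IH; first by move=> R Rs; apply: fs; rewrite inE Rs orbT.
have [fP uP] := fs P (mem_head P s).
have [w wP co_w] := coprime_linear_form fd fP uP vq.
exists (linear_form w * g); split.
- exact: dhomogM (linear_form_homog w) gd.
- move=> R; rewrite inE mevalM meval_linear_form => /predU1P[->|/gs->].
    by rewrite wP mul0r.
  by rewrite mulr0.
- by rewrite mevalM meval_linear_form coprimezMr co_w.
Qed.

Lemma homog_interpolation (s : seq 'rV[int]_n) : (0 < n)%N ->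
    {in s, forall P : 'rV_n, exists u, dot u (P 0) = 1} ->
  exists (d : nat) (f : {mpoly int[n]}),
    [/\ (0 < d)%N, f \is d.-homog, f != 0
      & {in s, forall P : 'rV_n, f.@[P 0] = 1}].
Proof.
move=> n_gt0; elim: s => [|Q s IH] us.
  (* With no values prescribed, any nonzero form of positive degree will do; [n_gt0] supplies a
     variable. *)
  exists 1%N, 'X_(Ordinal n_gt0); split=> //; first by rewrite dhomogX /= mdeg1.
  by rewrite -msupp_eq0 msuppX.
have us' : {in s, forall P : 'rV_n, exists u, dot u (P 0) = 1}.
  by move=> P Ps; apply: us; rewrite inE Ps orbT.
have [d [f [d_gt0 fd _ fs]]] := IH us'.
have [v vQ] := us Q (mem_head Q s).
have [g [gd gs co_g]] :
    exists g : {mpoly int[n]},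
      [/\ g \is (size s).-homog, {in s, forall P : 'rV_n, g.@[P 0] = 0}
        & coprimez f.@[Q 0] g.@[Q 0]].
  by apply: (coprime_vanishing_form fd); [exists v | move=> P Ps; split; auto].
have [k k_gt0 /dvdzP[c Ec]] := coprimez_expr_eq1_mod co_g.
(* The factor [(size s).+1] lifts the degree above that of [g], leaving room for a power of
   [linear_form v] to equalize degrees; [g.@[Q 0]] still divides the higher power of [f.@[Q 0]]
   minus 1. *)
pose e := (d * k * (size s).+1)%N.
have e_gt : (size s < e)%N by rewrite leq_pmull // muln_gt0 d_gt0.
have /dvdzP[b Eb] : (g.@[Q 0%R] %| f.@[Q 0%R] ^+ (k * (size s).+1) - 1)%Z.
  rewrite exprM -[X in _ - X](expr1n _ (size s).+1) subrXX.
  by rewrite Ec -mulrA mulrCA dvdz_mulr.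
pose h := f ^+ (k * (size s).+1) - b *: (g * linear_form v ^+ (e - size s)).
have hs : {in Q :: s, forall P : 'rV_n, h.@[P 0] = 1}.
  move=> P; rewrite inE /h mevalB mevalZ mevalM !rmorphXn /=.
  case/predU1P=> [->|Ps]; last by rewrite fs // gs // expr1n mul0r mulr0 subr0.
  by rewrite meval_linear_form vQ expr1n mulr1 -Eb subKr.
exists e, h; split=> //.
- exact: leq_trans e_gt.
- apply: rpredB.
    by rewrite /e -mulnA; apply: dhomogMn.
  apply: dhomogZ; rewrite -[e in e.-homog](subnKC (ltnW e_gt)).
  apply: dhomogM => //; rewrite -[X in X.-homog]mul1n.
  exact/dhomogMn/linear_form_homog.
- apply/eqP => h0; have /eqP := hs Q (mem_head Q s).
  by rewrite h0 meval0 eq_sym oner_eq0.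
Qed.

End Forms.

Theorem theorem0p1 (n : nat) (hn : (1 <= n)%N) (S : {fset 'rV[int]_n})
    (hS : forall Q : 'rV[int]_n, Q \in S -> \big[gcdz/0]_(i < n) Q 0 i = 1) :
  exists (d : nat) (f : {mpoly int[n]}),
    [/\ (1 <= d)%N, f \is d.-homog, f != 0
      & forall Q : 'rV[int]_n, Q \in S -> f.@[Q 0] = 1].
Proof.
apply: homog_interpolation hn _ => Q QS.
by have [u Eu] := Bezout_big_gcdz (Q 0); exists u; rewrite /dot Eu hS.
Qed.
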